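(* Let $R,S,T,P\in\mathbb{R}$ satisfy $R+T-P-S>0$, let $B>0$ and $\gamma\ge 0$, and define $$\gamma^\star=\frac{T+P-R-S}{R+T-P-S}.$$ Let $U_1,U_2:[-B,B]^2\to\mathbb{R}$ be the induced payoffs of the symmetric $2\times 2$ game with payoffs $R,S,T,P$ under the sigmoid semantics with coupling $\gamma$. Then for initializations near $\theta=(0,0)$, selfish gradient ascent points toward lower cooperation when $\gamma<\gamma^\star$ and toward higher cooperation when $\gamma>\gamma^\star$. That is: (a) if $\gamma<\gamma^\star$, there is a neighborhood $N$ of $(0,0)$ in $[-B,B]^2$ such that $\dfrac{\partial U_i}{\partial\theta_i}(\theta)<0$ for all $\theta\in N$ and both $i\in\{1,2\}$; (b) if $\gamma>\gamma^\star$, there is a neighborhood $N$ of $(0,0)$ in $[-B,B]^2$ such that $\dfrac{\partial U_i}{\partial\theta_i}(\theta)>0$ for all $\theta\in N$ and both $i\in\{1,2\}$.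
   Context: Symmetric $2\times2$ game: two players, each with actions $C$ (cooperate) and $D$ (defect). A player receives $R$ if both play $C$, $S$ if she plays $C$ and the opponent plays $D$, $T$ if she plays $D$ and the opponent plays $C$, and $P$ if both play $D$. For player $i$, let $-i$ denote the other player. If player $i$ plays $C$ with probability $p_i$ (independently), player $i$'s expected payoff is $$u_i(p_1,p_2)=p_ip_{-i}R+p_i(1-p_{-i})S+(1-p_i)p_{-i}T+(1-p_i)(1-p_{-i})P .$$ Sigmoid semantics with coupling $\gamma\ge0$: player $i$ chooses a parameter $\theta_i\in[-B,B]$, and the profile $\theta=(\theta_1,\theta_2)$ determines her probability of playing $C$ as $p_i(\theta)=\sigma(\theta_i+\gamma\theta_{-i})$, where $\sigma(x)=(1+e^{-x})^{-1}$. The induced payoffs are $U_i(\theta)=u_i(p_1(\theta),p_2(\theta))$. Selfish gradient ascent: each player $i$ simultaneously updates her own parameter in the direction of $\partial U_i/\partial\theta_i$ (with projection onto $[-B,B]$). A larger own parameter $\theta_i$ corresponds to higher cooperation and a smaller one to lower cooperation. *)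

(* Defs.v *)
From Stdlib Require Import Reals.
From Coquelicot Require Import Coquelicot.
Open Scope R_scope.

Inductive player := player1 | player2.

Definition other (i : player) : player :=
  match i with player1 => player2 | player2 => player1 end.

Definition coord (i : player) (x : R * R) : R :=
  match i with player1 => fst x | player2 => snd x end.

Definition set_coord (i : player) (x : R * R) (t : R) : R * R :=
  match i with player1 => (t, snd x) | player2 => (fst x, t) end.

(* The payoffs R, S, T, P of the game are written payR, payS, payT, payP, since
   R is the type of real numbers. [p] is the profile (p_1, p_2) of probabilities
   of playing C. *)
Definition expected_payoff (payR payS payT payP : R) (i : player) (p : R * R)
  : R :=
  let pi := coord i p in
  let pj := coord (other i) p in
  pi * pj * payR + pi * (1 - pj) * payS
  + (1 - pi) * pj * payT + (1 - pi) * (1 - pj) * payP.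

Definition sigmoid (x : R) : R := / (1 + exp (- x)).

Definition coop_prob (gamma : R) (theta : R * R) (i : player) : R :=
  sigmoid (coord i theta + gamma * coord (other i) theta).

(* The parameter space is the square [param_box B]; the formula for U_i makes
   sense for every profile in R * R, and this total function is what is
   differentiated below. At interior points of the square only the values on
   the square matter; at boundary points the derivative, when it exists, is also
   the one-sided derivative along the square. *)
Definition induced_payoff (payR payS payT payP gamma : R) (i : player)
  (theta : R * R) : R :=
  expected_payoff payR payS payT payP i
    (coop_prob gamma theta player1, coop_prob gamma theta player2).

Definition param_box (B : R) (theta : R * R) : Prop :=
  forall i : player, - B <= coord i theta <= B.

(* N is a neighborhood of x in the subspace A, as a subset of A. *)
Definition nbhd_in (A : R * R -> Prop) (x : R * R) (N : R * R -> Prop) : Prop :=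
  (forall y, N y -> A y) /\ within A (locally x) N.

(* Derive is total, hence the separate differentiability predicate. *)
Definition ex_partial (i : player) (f : R * R -> R) (x : R * R) : Prop :=
  ex_derive (fun t => f (set_coord i x t)) (coord i x).

Definition partial (i : player) (f : R * R -> R) (x : R * R) : R :=
  Derive (fun t => f (set_coord i x t)) (coord i x).

Definition gamma_star (payR payS payT payP : R) : R :=
  (payT + payP - payR - payS) / (payR + payT - payP - payS).

(* Main.v *)
Require Import Defs.
From Stdlib Require Import Reals Lra.
From Coquelicot Require Import Coquelicot.
Open Scope R_scope.

(** With [p_i] and [p_j] the cooperation probabilities, [sigma' = sigma (1 - sigma)]
    gives
    [dU_i/dtheta_i = p_i (1 - p_i) (p_j (R - T) + (1 - p_j) (S - P))
                     + gamma p_j (1 - p_j) (p_i (R - S) + (1 - p_i) (T - P))].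
    This is continuous in [theta], and at the origin, where both probabilities
    are [1/2], it equals [(R + T - P - S) (gamma - gamma_star) / 8]. *)

Lemma sigmoid_0 : sigmoid 0 = 1 / 2.
Proof. unfold sigmoid. rewrite Ropp_0, exp_0. field. Qed.

Lemma is_derive_sigmoid (x : R) :
  is_derive sigmoid x (sigmoid x * (1 - sigmoid x)).
Proof.
  pose proof (exp_pos (- x)).
  unfold sigmoid. auto_derive; [lra | field; lra].
Qed.

Lemma continuous_sigmoid (x : R) : continuous sigmoid x.
Proof.
  apply (ex_derive_continuous sigmoid).
  eexists. apply is_derive_sigmoid.
Qed.

Definition payoff_gradient (payR payS payT payP gamma : R) (i : player)
  (theta : R * R) : R :=
  let pi := coop_prob gamma theta i in
  let pj := coop_prob gamma theta (other i) in
  pi * (1 - pi) * (pj * (payR - payT) + (1 - pj) * (payS - payP))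
  + gamma * (pj * (1 - pj)) * (pi * (payR - payS) + (1 - pi) * (payT - payP)).

(** Chain and product rules: the own parameter enters the player's own probability with coefficient
    1 and the opponent's with coefficient [gamma], which yields the two summands. *)
Lemma is_derive_payoff (payR payS payT payP gamma : R) (i : player)
  (theta : R * R) :
  is_derive
    (fun t => induced_payoff payR payS payT payP gamma i (set_coord i theta t))
    (coord i theta) (payoff_gradient payR payS payT payP gamma i theta).
Proof.
  destruct theta as [x y].
  assert (Hsig : forall z, ex_derive sigmoid z)
    by (intro z; eexists; apply is_derive_sigmoid).
  (* The eta-expanded form matches the [Derive] terms that [auto_derive] leaves for [sigmoid]. *)
  assert (HD : forall z, Derive (fun u => sigmoid u) z
                         = sigmoid z * (1 - sigmoid z))
    by (intro z; apply is_derive_unique, is_derive_sigmoid).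
  destruct i;
    unfold payoff_gradient, induced_payoff, expected_payoff, coop_prob; simpl;
    (auto_derive; [repeat split; apply Hsig | rewrite ?HD; ring]).
Qed.

Lemma continuous_coord (i : player) (theta : R * R) :
  continuous (coord i) theta.
Proof.
  destruct theta, i; [apply continuous_fst | apply continuous_snd].
Qed.

Lemma continuous_coop_prob (gamma : R) (i : player) (theta : R * R) :
  continuous (fun th => coop_prob gamma th i) theta.
Proof.
  unfold coop_prob.
  apply (continuous_comp _ sigmoid); [| apply continuous_sigmoid].
  apply @continuous_plus; [apply continuous_coord |].
  apply (continuous_scal_r gamma (coord (other i))), continuous_coord.
Qed.

(* Coquelicot's [continuous_plus] and [continuous_mult] in terms of the operations
   of [R]: unifying these with the generic [plus] and [mult] on a large term is
   very slow. *)
Lemma continuous_Rplus {V : UniformSpace} (f g : V -> R) (x : V) :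
  continuous f x -> continuous g x -> continuous (fun y => f y + g y) x.
Proof. exact (continuous_plus f g x). Qed.

Lemma continuous_Rminus {V : UniformSpace} (f g : V -> R) (x : V) :
  continuous f x -> continuous g x -> continuous (fun y => f y - g y) x.
Proof. exact (continuous_minus f g x). Qed.

Lemma continuous_Rmult {V : UniformSpace} (f g : V -> R) (x : V) :
  continuous f x -> continuous g x -> continuous (fun y => f y * g y) x.
Proof. exact (continuous_mult f g x). Qed.

Lemma continuous_payoff_gradient (payR payS payT payP gamma : R) (i : player)
  (theta : R * R) :
  continuous (payoff_gradient payR payS payT payP gamma i) theta.
Proof.
  unfold payoff_gradient.
  repeat first
    [ simple apply continuous_const
    | simple apply continuous_coop_prob
    | simple apply continuous_Rminus
    | simple apply continuous_Rplus
    | simple apply continuous_Rmult ].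
Qed.

(** At the origin both sigmoid arguments vanish whatever [gamma] is, so the gradient is affine in
    [gamma], with root [gamma_star]. *)
Lemma payoff_gradient_0 (payR payS payT payP gamma : R) (i : player) :
  payR + payT - payP - payS > 0 ->
  payoff_gradient payR payS payT payP gamma i (0, 0)
  = (payR + payT - payP - payS) / 8
    * (gamma - gamma_star payR payS payT payP).
Proof.
  intro Hpay.
  assert (Hp : forall j, coop_prob gamma (0, 0) j = 1 / 2).
  { intro j. rewrite <- sigmoid_0. unfold coop_prob.
    f_equal. destruct j; simpl; ring. }
  unfold payoff_gradient, gamma_star. rewrite !Hp. field. lra.
Qed.

(** Treats both signs at once: [Q] will be the negative or the positive reals. Continuity of the
    gradient and openness of [Q] spread the condition from the origin to nearby points. *)
Lemma payoff_gradient_nbhd (payR payS payT payP B gamma : R) (Q : R -> Prop) :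
  open Q ->
  (forall i, Q (payoff_gradient payR payS payT payP gamma i (0, 0))) ->
  exists N : R * R -> Prop, nbhd_in (param_box B) (0, 0) N /\
    forall theta, N theta -> forall i : player,
      let U := induced_payoff payR payS payT payP gamma in
      ex_partial i (U i) theta /\ Q (partial i (U i) theta).
Proof.
  intros HQ H0.
  set (g := payoff_gradient payR payS payT payP gamma) in *.
  (* The largest candidate: all points of the box where both gradients lie in [Q]. *)
  exists (fun theta => param_box B theta /\ forall i, Q (g i theta)).
  split.
  - split; [tauto |].
    assert (Hloc : forall i, locally (0, 0) (fun theta => Q (g i theta)))
      by (intro i; apply continuous_payoff_gradient, HQ, H0).
    (* Intersecting the two players' neighborhoods lets one [N] serve both. *)
    generalize (filter_and _ _ (Hloc player1) (Hloc player2)).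
    unfold within. apply filter_imp. intros theta [H1 H2] Hbox.
    split; [exact Hbox | intros []; assumption].
  - intros theta [_ HN] i U.
    pose proof (is_derive_payoff payR payS payT payP gamma i theta) as Hd.
    split.
    + eexists. exact Hd.
    + replace (partial i (U i) theta) with (g i theta); [apply HN |].
      symmetry. exact (is_derive_unique _ _ _ Hd).
Qed.

Theorem theorem3 (payR payS payT payP B gamma : R)
  (Hpay : payR + payT - payP - payS > 0) (HB : B > 0) (Hgamma : gamma >= 0) :
  let U := induced_payoff payR payS payT payP gamma in
  (gamma < gamma_star payR payS payT payP ->
     exists N : R * R -> Prop, nbhd_in (param_box B) (0, 0) N /\
       forall theta, N theta -> forall i : player,
         ex_partial i (U i) theta /\ partial i (U i) theta < 0) /\
  (gamma > gamma_star payR payS payT payP ->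
     exists N : R * R -> Prop, nbhd_in (param_box B) (0, 0) N /\
       forall theta, N theta -> forall i : player,
         ex_partial i (U i) theta /\ partial i (U i) theta > 0).
Proof.
  intro U. split; intro Hg.
  - apply (payoff_gradient_nbhd _ _ _ _ B gamma (fun r => r < 0)).
    + apply open_lt.
    (* By [Hpay] the factor before [gamma - gamma_star] is positive, so that difference decides the
       sign. *)
    + intro i. rewrite payoff_gradient_0 by exact Hpay. nra.
  - apply (payoff_gradient_nbhd _ _ _ _ B gamma (fun r => r > 0)).
    + apply open_gt.
    + intro i. rewrite payoff_gradient_0 by exact Hpay. nra.
Qed.
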